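(* For any string $\sigma \in 2^{<\omega}$, any $\delta \in (0,1]$ and any set $A \subseteq \mathbb{N}$ of lower density at least $\delta$, \[ C(\sigma \mid [A]^\omega) \geq C^{0'}(\sigma) - \log(1/\delta) - O(\log\log(1/\delta)), \] where the constant hidden by the $O(\cdot)$ notation does not depend on $\sigma$ or $A$.
   Context: $C$ denotes plain Kolmogorov complexity and $C^Y$ Kolmogorov complexity relative to an oracle $Y$; $0'$ is the halting problem; logarithms are base 2. $[A]^\omega$ is the family of all infinite subsets of $A$. For a family $\mathcal{F}$ of subsets of $\mathbb{N}$, $C(\sigma \mid \mathcal{F}) = \max_{Y \in \mathcal{F}} C^Y(\sigma)$. The lower density of $A$ is $\liminf_{n\to\infty}\frac{|A\cap\{0,\ldots,n\}|}{n+1}$.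
   Formalization: Since log log(1/δ) is undefined at δ = 1 and at most 0 for δ ≥ 1/2, the error term O(log log(1/δ)) is read as c·max(1, log log(1/δ)), with c independent of σ, A and δ; for δ ≤ 1/4 this is literally c·log log(1/δ). *)

(* Defs.v *)
From mathcomp Require Export all_boot all_order all_algebra.
From mathcomp Require Export all_classical all_reals all_analysis.
From mathcomp Require Import zify.
Set Implicit Arguments.
Unset Strict Implicit.
Unset Printing Implicit Defensive.
Import Order.TTheory GRing.Theory Num.Theory.

Local Open Scope classical_set_scope.
Local Open Scope nat_scope.

(* Cantor's pairing; [cunpair] walks along the diagonals n times. *)
Definition cpair (x y : nat) : nat := 'C((x + y).+1, 2) + y.

Definition cunpair (n : nat) : nat * nat :=
  iter n (fun xy => if xy.1 is x.+1 then (x, xy.2.+1) else (xy.2.+1, 0)) (0, 0).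

Lemma cunpairK n : cpair (cunpair n).1 (cunpair n).2 = n.
Proof.
elim: n => // n; rewrite [cunpair n.+1]/cunpair iterS -/(cunpair n).
case: (cunpair n) => -[|x] y /= <-; rewrite /cpair.
  by rewrite !addn0 add0n ['C(y.+2, 2)]binS bin1 addnS.
by rewrite -addSnnS addnS.
Qed.

Lemma cpairK x y : cunpair (cpair x y) = (x, y).
Proof.
have inj a b c d : cpair a b = cpair c d -> (a, b) = (c, d).
  have lt s t v w : v <= s -> s < t -> 'C(s.+1, 2) + v < 'C(t.+1, 2) + w.
    move=> vs st; have : 'C(s.+2, 2) <= 'C(t.+1, 2) by apply: leq_bin2l; lia.
    by rewrite [X in X <= _]binS bin1; lia.
  rewrite /cpair => e.
  case: (ltngtP (a + b) (c + d)) => h.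
  - by have := lt _ _ b d (leq_addl a b) h; lia.
  - by have := lt _ _ d b (leq_addl c d) h; lia.
  - by rewrite h in e; congr pair; lia.
have := cunpairK (cpair x y).
by case: (cunpair _) => a b /= /inj.
Qed.

(* Oracle programs for partial functions nat -> nat, arguments being packed
   with [cpair]:
     CLeft <x,y> = x,  CRight <x,y> = y,  COracle n = 1 if n is in the oracle,
     else 0,  CPair f g n = <f n, g n>,  CComp f g n = f (g n),
     CPrec f g <a,0> = f a,  CPrec f g <a,n+1> = g <a,<n, CPrec f g <a,n>>>,
     CMu f a = the least n such that f <a,n> = 0, all f <a,m> with m < n being
     defined. *)
Inductive code : Type :=
| CZero | CSucc | CLeft | CRight | COracle
| CPair of code & code
| CComp of code & code
| CPrec of code & code
| CMu of code.

Fixpoint prec_graph (F G : nat -> nat -> Prop) (a n : nat) : nat -> Prop :=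
  match n with
  | 0 => F a
  | n'.+1 => fun y =>
      exists2 m, prec_graph F G a n' m & G (cpair a (cpair n' m)) y
  end.

(* [eval Y c x y]: program c with oracle Y halts on input x with output y. *)
Fixpoint eval (Y : set nat) (c : code) : nat -> nat -> Prop :=
  match c with
  | CZero => fun _ y => y = 0
  | CSucc => fun x y => y = x.+1
  | CLeft => fun x y => y = (cunpair x).1
  | CRight => fun x y => y = (cunpair x).2
  | COracle => fun x y => y = (x \in Y)
  | CPair f g => fun x y =>
      exists a b, [/\ eval Y f x a, eval Y g x b & y = cpair a b]
  | CComp f g => fun x y => exists2 z, eval Y g x z & eval Y f z y
  | CPrec f g => fun x y =>
      prec_graph (eval Y f) (eval Y g) (cunpair x).1 (cunpair x).2 y
  | CMu f => fun x y =>
      eval Y f (cpair x y) 0 /\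
      forall m, m < y -> exists k, eval Y f (cpair x m) k.+1
  end.

Lemma eval_inj Y c x y z : eval Y c x y -> eval Y c x z -> y = z.
Proof.
elim: c x y z => /=; try by move=> x y z -> ->.
- move=> f IHf g IHg x y z [a [b [fa gb ->]]] [a' [b' [fa' gb' ->]]].
  by rewrite (IHf _ _ _ fa fa') (IHg _ _ _ gb gb').
- move=> f IHf g IHg x y z [u gu fu] [v gv fv].
  by rewrite (IHg _ _ _ gv gu) in fv; exact: IHf fu fv.
- move=> f IHf g IHg x y z; move: (cunpair x).1 (cunpair x).2 => a n.
  elim: n y z => /= [|n IHn] y z; first exact: IHf.
  move=> [u pu gu] [v pv gv].
  by rewrite (IHn _ _ pv pu) in gv; exact: IHg gu gv.
- move=> f IHf x y z [y0 yP] [z0 zP].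
  case: (ltngtP y z) => // h.
    by have [k /(IHf _ _ _ y0)] := zP _ h.
  by have [k /(IHf _ _ _ z0)] := yP _ h.
Qed.

(* Goedel numbering of programs (a bijection onto nat). *)
Fixpoint code_num (c : code) : nat :=
  match c with
  | CZero => 0 | CSucc => 1 | CLeft => 2 | CRight => 3 | COracle => 4
  | CPair f g => 4 * cpair (code_num f) (code_num g) + 5
  | CComp f g => 4 * cpair (code_num f) (code_num g) + 6
  | CPrec f g => 4 * cpair (code_num f) (code_num g) + 7
  | CMu f => 4 * code_num f + 8
  end.

(* 0'; ordinary (oracle-free) computation is computation with the empty
   oracle. *)
Definition halting_problem : set nat :=
  [set n | exists c x y, n = cpair (code_num c) x /\ eval set0 c x y].

(* Bijective base-2 numeration: a bijection between strings and nat through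
   which programs act on strings. *)
Fixpoint str_num (s : seq bool) : nat :=
  if s is b :: s' then 2 * str_num s' + 1 + b else 0.

Lemma str_num_bij : bijective str_num.
Proof.
have inj : injective str_num.
  elim=> [|b s IH] [|b' s'] //=; try lia.
  by case: b b' => -[] /= e; try lia; congr cons; apply: IH; lia.
have surj n : exists s, str_num s = n.
  elim/ltn_ind: n => -[_|n IH]; first by exists [::].
  have [|s sP] := IH n./2; first by lia.
  by exists (odd n :: s) => /=; rewrite sP; lia.
by exists (fun n => sval (cid (surj n))) => [s|n]; first apply: inj;
  case: cid.
Qed.

(* [runs U Y p s] is U^Y(p) = s. *)
Definition runs (U : code) (Y : set nat) (p s : seq bool) : Prop :=
  eval Y U (str_num p) (str_num s).

(* U is an additively optimal oracle machine; the constant depends on the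
   simulated machine M only, not on the oracle. *)
Definition optimal (U : code) : Prop :=
  forall M : code, exists k : nat, forall (Y : set nat) (p s : seq bool),
    runs M Y p s -> exists2 q, size q <= size p + k & runs U Y q s.

(* Minimum and maximum of a set of naturals (0 when there is none). *)
Definition nat_min (S : set nat) : nat :=
  xget 0 [set n | S n /\ forall m, S m -> n <= m].

Definition nat_max (S : set nat) : nat :=
  xget 0 [set n | S n /\ forall m, S m -> m <= n].

(* Plain complexity C^Y(s). *)
Definition KC (U : code) (Y : set nat) (s : seq bool) : nat :=
  nat_min [set n | exists2 p, size p = n & runs U Y p s].

(* C(s | F) *)
Definition KC_family (U : code) (F : set (set nat)) (s : seq bool) : nat :=
  nat_max [set KC U Y s | Y in F].

Lemma nat_minP (S : set nat) : S !=set0 ->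
  S (nat_min S) /\ forall m, S m -> nat_min S <= m.
Proof.
move=> [n0 Sn0]; rewrite /nat_min.
have [n /asboolP Sn nP] :=
  @ex_minnP (fun n => `[< S n >]) (ex_intro _ n0 (asboolT Sn0)).
by case: xgetP => [m -> //|/(_ n)[]]; split=> // m /asboolT/nP.
Qed.

Lemma nat_maxP (S : set nat) b : S !=set0 -> (forall m, S m -> m <= b) ->
  S (nat_max S) /\ forall m, S m -> m <= nat_max S.
Proof.
move=> [n0 Sn0] Sb; rewrite /nat_max.
have Sb' n : `[< S n >] -> n <= b by move/asboolP/Sb.
have [n /asboolP Sn nP] :=
  @ex_maxnP (fun n => `[< S n >]) b (ex_intro _ n0 (asboolT Sn0)) Sb'.
by case: xgetP => [m -> //|/(_ n)[]]; split=> // m /asboolT/nP.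
Qed.

Lemma optimal_runs U : optimal U ->
  exists k, forall Y s, exists2 q, size q <= size s + k & runs U Y q s.
Proof.
move=> /(_ (CPair CLeft CRight))[k kP]; exists k => Y s; apply: kP.
by exists (cunpair (str_num s)).1, (cunpair (str_num s)).2; rewrite cunpairK.
Qed.

Lemma KC_P U Y s : optimal U ->
  (exists2 p, size p = KC U Y s & runs U Y p s) /\
  forall p, runs U Y p s -> KC U Y s <= size p.
Proof.
move=> /optimal_runs[k /(_ Y s)[q _ qs]].
have [|h1 h2] := @nat_minP [set n | exists2 p, size p = n & runs U Y p s].
  by exists (size q); exists q.
by split=> // p ps; apply: h2; exists p.
Qed.

Lemma KC_familyP U F s : optimal U -> F !=set0 ->
  (exists2 Y, F Y & KC U Y s = KC_family U F s) /\
  forall Y, F Y -> KC U Y s <= KC_family U F s.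
Proof.
move=> optU [Y0 FY0]; have [k kP] := optimal_runs optU.
have [||h1 h2] := @nat_maxP [set KC U Y s | Y in F] (size s + k).
- by exists (KC U Y0 s); exists Y0.
- move=> _ [Y _ <-]; have [q qs /(KC_P Y s optU).2 h] := kP Y s.
  exact: leq_trans h qs.
- by split=> // Y FY; apply: h2; exists Y.
Qed.

(* [A]^omega *)
Definition infinite_subsets (A : set nat) : set (set nat) :=
  [set Y | Y `<=` A /\ infinite_set Y].

Local Open Scope ring_scope.

Definition lower_density (R : realType) (A : set nat) : R :=
  limn_inf (fun n : nat => (\sum_(i < n.+1) ((i : nat) \in A))%N%:R / n.+1%:R).

Definition log2 (R : realType) (x : R) : R := ln x / ln 2.

(* Main.v *)
Require Import Defs.
From mathcomp Require Import zify lra.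
Set Implicit Arguments.
Unset Strict Implicit.
Unset Printing Implicit Defensive.
Import Order.TTheory GRing.Theory Num.Theory.
Local Open Scope classical_set_scope.
Local Open Scope nat_scope.

(* Let k = C(sigma | [A]^omega), and pick j with 2^-j < delta.  For a finite
   set E seen as an oracle of length t, let L_E be the set of the at most
   2^(k+1) numbers v printed within t by programs p < 2^(k+1).  With the
   oracle 0' we enumerate candidates v together with thresholds M, accepting
   (v, M) whenever the following remains possible: there are sets B_v, one for
   each accepted v, such that B_v has density at least 2^-j in [0, m) for all
   m >= M, and #(L_E U {v : E <= B_v}) <= 2^(k+1) for every nonempty finite
   E.  By compactness this is a Pi^0_1 question, which 0' answers.

   Taking singletons for E and averaging over [0, m), at most 2^(k+1+j)
   candidates are accepted.  On the other hand sigma is accepted: otherwise take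
   the final sets B_v, and B_sigma := A \ [0, N) where N exceeds all elements of
   the finite intersections of A with some of the B_v.  If E violated the
   condition, then E would lie in such an intersection which is infinite, hence
   would extend to an infinite Y in the same intersection; as sigma is in L_Y,
   the condition would already fail for the B_v and some initial segment of Y.

   So sigma is determined, relative to 0', by j, k and an index below
   2^(k+1+j), i.e. by about k + j + 2 log j bits. *)

(** * Computable functions *)

Definition computable (Y : set nat) (f : nat -> nat) : Prop :=
  exists c, forall x, eval Y c x (f x).

Definition cleft (x : nat) : nat := (cunpair x).1.
Definition cright (x : nat) : nat := (cunpair x).2.

Lemma cleftK x y : cleft (cpair x y) = x.
Proof. by rewrite /cleft cpairK. Qed.

Lemma crightK x y : cright (cpair x y) = y.
Proof. by rewrite /cright cpairK. Qed.

Lemma cpair_inj a b c d : cpair a b = cpair c d -> a = c /\ b = d.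
Proof.
move=> e; split; first by rewrite -(cleftK a b) e cleftK.
by rewrite -(crightK a b) e crightK.
Qed.

Lemma leq_cleft n : cleft n <= n.
Proof.
rewrite -{2}(cunpairK n) -/(cleft n) -/(cright n) /cpair binS bin1.
by apply: leq_trans (leq_addr _ _); apply: leq_trans (leq_addl _ _);
  exact: leq_addr.
Qed.

Lemma leq_cright n : cright n <= n.
Proof.
by rewrite -{2}(cunpairK n) -/(cleft n) -/(cright n) /cpair leq_addl.
Qed.

Lemma ltn_cpair v a t : v < t -> a < t -> cpair v a < cpair t t.
Proof.
move=> vt at_; rewrite /cpair -addnS; apply: leq_add => //.
by apply: leq_bin2l; lia.
Qed.

Lemma code_num_inj : injective code_num.
Proof.
elim=> [|||||f IHf g IHg|f IHf g IHg|f IHf g IHg|f IHf]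
  [|||||f' g'|f' g'|f' g'|f'] //= e; try lia.
1-3: by have /cpair_inj[/IHf-> /IHg->] : cpair (code_num f) (code_num g) =
  cpair (code_num f') (code_num g') by lia.
by rewrite (IHf f') //; lia.
Qed.

(* The number e stands for the finite set of its binary digits equal to 1. *)
Definition bit (e n : nat) : bool := odd (iter n half e).

Section Closure.
Variable Y : set nat.
Notation comp := (computable Y).

Lemma computable_ext f g : f =1 g -> comp f -> comp g.
Proof. by move=> fg [c cP]; exists c => x; rewrite -fg. Qed.

Lemma computable_comp f g : comp f -> comp g -> comp (fun x => f (g x)).
Proof. by move=> [c cP] [d dP]; exists (CComp c d) => x /=; exists (g x). Qed.

Lemma computable_id : comp (fun x => x).
Proof.
exists (CPair CLeft CRight) => x /=.
by exists (cunpair x).1, (cunpair x).2; rewrite cunpairK.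
Qed.

Lemma computable_succ f : comp f -> comp (fun x => (f x).+1).
Proof. by apply: (computable_comp (f := succn)); exists CSucc. Qed.

Lemma computable_left f : comp f -> comp (fun x => cleft (f x)).
Proof. by apply: computable_comp; exists CLeft. Qed.

Lemma computable_right f : comp f -> comp (fun x => cright (f x)).
Proof. by apply: computable_comp; exists CRight. Qed.

Lemma computable_oracle f : comp f -> comp (fun x => f x \in Y).
Proof. by apply: (computable_comp (f := fun x => x \in Y)); exists COracle. Qed.

Lemma computable_pair f g :
  comp f -> comp g -> comp (fun x => cpair (f x) (g x)).
Proof.
by move=> [c cP] [d dP]; exists (CPair c d) => x /=; exists (f x), (g x).
Qed.

Lemma computable_cst n : comp (fun=> n).
Proof. by elim: n => [|n]; [exists CZero|exact: computable_succ]. Qed.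

(** Here [r] may be any function obeying the two recursion equations, so a library function
    qualifies once these are checked; [x] stays available to each step inside the pair. *)
Lemma computable_rec (r : nat -> nat -> nat) f g h :
  (forall x, r x 0 = f x) ->
  (forall x n, r x n.+1 = g (cpair x (cpair n (r x n)))) ->
  comp f -> comp g -> comp h -> comp (fun x => r x (h x)).
Proof.
move=> r0 rS [c cP] [d dP] hP.
have [e eP] := computable_pair computable_id hP.
exists (CComp (CPrec c d) e) => x /=; exists (cpair x (h x)) => //.
rewrite cpairK /=; elim: (h x) => [|n IHn] /=; first by rewrite r0.
by exists (r x n) => //; rewrite rS.
Qed.

Lemma computable_add f g : comp f -> comp g -> comp (fun x => f x + g x).
Proof.
move=> fP gP; apply: (computable_rec (r := fun x n => f x + n)
  (g := fun z => (cright (cright z)).+1) _ _ fP _ gP) => [x|x n|].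
- by rewrite addn0.
- by rewrite !crightK addnS.
- by apply/computable_succ/computable_right/computable_right/computable_id.
Qed.

Lemma computable_pred f : comp f -> comp (fun x => (f x).-1).
Proof.
move=> fP; apply: (computable_rec (r := fun _ n => n.-1)
  (g := fun z => cleft (cright z)) _ _ (computable_cst 0) _ fP) => //.
- by move=> x n; rewrite crightK cleftK.
- by apply/computable_left/computable_right/computable_id.
Qed.

Lemma computable_sub f g : comp f -> comp g -> comp (fun x => f x - g x).
Proof.
move=> fP gP; apply: (computable_rec (r := fun x n => f x - n)
  (g := fun z => (cright (cright z)).-1) _ _ fP _ gP) => [x|x n|].
- by rewrite subn0.
- by rewrite !crightK subnS.
- by apply/computable_pred/computable_right/computable_right/computable_id.
Qed.

Lemma computable_mul f g : comp f -> comp g -> comp (fun x => f x * g x).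
Proof.
move=> fP gP; apply: (computable_rec (r := fun x n => f x * n)
  (g := fun z => f (cleft z) + cright (cright z)) _ _ (computable_cst 0) _ gP)
  => [x|x n|].
- by rewrite muln0.
- by rewrite !crightK cleftK mulnS.
- apply: computable_add; first apply: computable_comp => //.
    exact/computable_left/computable_id.
  by apply/computable_right/computable_right/computable_id.
Qed.

Lemma computable_if (b : nat -> bool) f g :
  comp (fun x => b x) -> comp f -> comp g ->
  comp (fun x => if b x then f x else g x).
Proof.
move=> bP fP gP.
apply: (computable_ext (f := fun x => f x * b x + g x * (1 - b x))) => [x|].
  by case: (b x); lia.
by apply: computable_add; apply: computable_mul => //;
  apply: computable_sub => //; exact: computable_cst.
Qed.

Lemma computable_leq f g : comp f -> comp g -> comp (fun x => f x <= g x).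
Proof.
move=> fP gP; apply: (computable_ext (f := fun x => 1 - (f x - g x))) => [x|].
  by case: leqP; lia.
by apply: computable_sub; [exact: computable_cst|exact: computable_sub].
Qed.

Lemma computable_neg (b : nat -> bool) :
  comp (fun x => b x) -> comp (fun x => ~~ b x).
Proof.
move=> bP; apply: (computable_ext (f := fun x => 1 - b x)) => [x|].
  by case: (b x).
by apply: computable_sub => //; exact: computable_cst.
Qed.

Lemma computable_and (b c : nat -> bool) :
  comp (fun x => b x) -> comp (fun x => c x) -> comp (fun x => b x && c x).
Proof.
move=> bP cP; apply: (computable_ext (f := fun x => b x * c x)) => [x|].
  by case: (b x); case: (c x).
exact: computable_mul.
Qed.

Lemma computable_or (b c : nat -> bool) :
  comp (fun x => b x) -> comp (fun x => c x) -> comp (fun x => b x || c x).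
Proof.
move=> bP cP; apply: (computable_ext (f := fun x => ~~ (~~ b x && ~~ c x))).
  by move=> x; case: (b x); case: (c x).
by apply/computable_neg/computable_and; exact: computable_neg.
Qed.

Lemma computable_imply (b c : nat -> bool) :
  comp (fun x => b x) -> comp (fun x => c x) -> comp (fun x => b x ==> c x).
Proof.
move=> bP cP; apply: (computable_ext (f := fun x => ~~ b x || c x)).
  by move=> x; rewrite implybE.
by apply/computable_or => //; exact: computable_neg.
Qed.

Lemma computable_eq f g : comp f -> comp g -> comp (fun x => f x == g x).
Proof.
move=> fP gP.
apply: (computable_ext (f := fun x => (f x <= g x) && (g x <= f x))).
  by move=> x; rewrite -eqn_leq.
by apply: computable_and; exact: computable_leq.
Qed.

Lemma computable_exp2 f : comp f -> comp (fun x => 2 ^ f x).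
Proof.
move=> fP; apply: (computable_rec (r := fun x n => 2 ^ n)
  (g := fun z => 2 * cright (cright z)) _ _ (computable_cst 1) _ fP)
  => // [x n|].
- by rewrite !crightK expnS.
- apply: computable_mul; first exact: computable_cst.
  exact/computable_right/computable_right/computable_id.
Qed.

Lemma computable_odd f : comp f -> comp (fun x => odd (f x)).
Proof.
move=> fP; apply: (computable_rec (r := fun x n => odd n)
  (g := fun z => 1 - cright (cright z)) _ _ (computable_cst 0) _ fP)
  => // [x n|].
- by rewrite !crightK /=; case: odd.
- apply: computable_sub; first exact: computable_cst.
  exact/computable_right/computable_right/computable_id.
Qed.

Lemma computable_half f : comp f -> comp (fun x => (f x)./2).
Proof.
move=> fP; apply: (computable_rec (r := fun x n => n./2)
  (g := fun z => odd (cleft (cright z)) + cright (cright z))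
  _ _ (computable_cst 0) _ fP) => // [x n|].
- by rewrite !crightK cleftK -uphalf_half.
- apply: computable_add.
    exact/computable_odd/computable_left/computable_right/computable_id.
  exact/computable_right/computable_right/computable_id.
Qed.

Lemma computable_bit f g : comp f -> comp g -> comp (fun x => bit (f x) (g x)).
Proof.
move=> fP gP; apply: computable_odd.
apply: (computable_rec (r := fun x n => iter n half (f x))
  (g := fun z => (cright (cright z))./2) _ _ fP _ gP) => // [x n|].
- by rewrite !crightK.
- by apply/computable_half/computable_right/computable_right/computable_id.
Qed.

Lemma computable_count (p : nat -> nat -> bool) f :
  comp (fun z => p (cleft z) (cright z)) -> comp f ->
  comp (fun x => count (p x) (iota 0 (f x))).
Proof.
move=> pP fP; apply: (computable_rec (r := fun x n => count (p x) (iota 0 n))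
  (g := fun z => cright (cright z) + p (cleft z) (cleft (cright z)))
  _ _ (computable_cst 0) _ fP) => // [x n|].
- by rewrite !crightK !cleftK -addn1 iotaD count_cat /= addn0.
- apply: computable_add; first
    exact/computable_right/computable_right/computable_id.
  apply: (computable_ext (f := fun z => 
      p (cleft (cpair (cleft z) (cleft (cright z))))
        (cright (cpair (cleft z) (cleft (cright z)))))) => [z|].
    by rewrite cleftK crightK.
  apply: (computable_comp pP); apply: computable_pair.
    exact/computable_left/computable_id.
  by apply/computable_left/computable_right/computable_id.
Qed.

Lemma computable_all (p : nat -> nat -> bool) f :
  comp (fun z => p (cleft z) (cright z)) -> comp f ->
  comp (fun x => all (p x) (iota 0 (f x))).
Proof.
move=> pP fP.
apply: (computable_ext (f := fun x => count (p x) (iota 0 (f x)) == f x)).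
  by move=> x; rewrite all_count size_iota.
by apply: computable_eq => //; exact: computable_count.
Qed.

Lemma computable_has (p : nat -> nat -> bool) f :
  comp (fun z => p (cleft z) (cright z)) -> comp f ->
  comp (fun x => has (p x) (iota 0 (f x))).
Proof.
move=> pP fP.
apply: (computable_ext (f := fun x => 1 <= count (p x) (iota 0 (f x)))) => [x|].
  by rewrite has_count.
apply: computable_leq; first exact: computable_cst.
exact: computable_count.
Qed.

Lemma computable_find (p : nat -> nat -> bool) f :
  comp (fun z => p (cleft z) (cright z)) -> comp f ->
  comp (fun x => find (p x) (iota 0 (f x))).
Proof.
move=> pP fP.
(* The position of the first hit equals the number of [n] such that no element of [0, n] is a hit;
   this reduces [find] to counting. *)
apply: (computable_ext (f := fun x =>
  count (fun n => ~~ has (p x) (iota 0 n.+1)) (iota 0 (f x)))) => [x|].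
  elim: (f x) => // n IHn.
  rewrite -[n.+1]addn1 !iotaD count_cat find_cat {}IHn size_iota.
  have -> : count (fun m => ~~ has (p x) (iota 0 m.+1)) (iota (0 + n) 1)
      = ~~ has (p x) (iota 0 n.+1) by exact: addn0.
  rewrite -[n.+1]addn1 iotaD has_cat.
  have [h|h] := boolP (has _ _); first by rewrite addn0.
  by rewrite (hasNfind h) size_iota /= add0n orbF; case: (p x n).
apply: computable_count => //; apply: computable_neg.
apply: (computable_has (p := fun z => p (cleft z))); last first.
  by apply/computable_succ/computable_right/computable_id.
apply: (computable_ext (f := fun z => 
    p (cleft (cpair (cleft (cleft z)) (cright z)))
      (cright (cpair (cleft (cleft z)) (cright z))))) => [z|].
  by rewrite cleftK crightK.
apply: (computable_comp pP); apply: computable_pair.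
  by apply/computable_left/computable_left/computable_id.
by apply/computable_right/computable_id.
Qed.

End Closure.

(** Recursion on the syntax of the function; subgoals that match no closure rule and are not
    constant are left to the caller. *)
Ltac computable_tac :=
  cbv beta;
  lazymatch goal with
  | H : computable _ ?f |- computable _ ?f => exact: H
  | |- computable _ (fun x => x) => exact: computable_id
  | |- computable _ cleft => exact/computable_left/computable_id
  | |- computable _ cright => exact/computable_right/computable_id
  | |- computable _ (fun x => S (@?f x)) =>
      apply: (@computable_succ _ f); computable_tac
  | |- computable _ (fun x => cleft (@?f x)) =>
      apply: (@computable_left _ f); computable_tac
  | |- computable _ (fun x => cright (@?f x)) =>
      apply: (@computable_right _ f); computable_tac
  | |- computable _ (fun x => cpair (@?f x) (@?g x)) =>
      apply: (@computable_pair _ f g); computable_tac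
  | |- computable _ (fun x => addn (@?f x) (@?g x)) =>
      apply: (@computable_add _ f g); computable_tac
  | |- computable _ (fun x => subn (@?f x) (@?g x)) =>
      apply: (@computable_sub _ f g); computable_tac
  | |- computable _ (fun x => muln (@?f x) (@?g x)) =>
      apply: (@computable_mul _ f g); computable_tac
  | |- computable _ (fun x => predn (@?f x)) =>
      apply: (@computable_pred _ f); computable_tac
  | |- computable _ (fun x => expn 2 (@?f x)) =>
      apply: (@computable_exp2 _ f); computable_tac
  | |- computable _ (fun x => if _ then _ else _) =>
      refine (@computable_if _ (fun x => _) (fun x => _) (fun x => _) _ _ _);
      computable_tac
  | |- computable _ (fun x => nat_of_bool (bit (@?f x) (@?g x))) =>
      apply: (@computable_bit _ f g); computable_tac
  | |- computable _ (fun x => nat_of_bool (leq (@?f x) (@?g x))) =>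
      apply: (@computable_leq _ f g); computable_tac
  | |- computable _ (fun x => nat_of_bool (@eq_op _ (@?f x) (@?g x))) =>
      apply: (@computable_eq _ f g); computable_tac
  | |- computable _ (fun x => nat_of_bool (negb (@?f x))) =>
      apply: (@computable_neg _ f); computable_tac
  | |- computable _ (fun x => nat_of_bool (andb (@?f x) (@?g x))) =>
      apply: (@computable_and _ f g); computable_tac
  | |- computable _ (fun x => nat_of_bool (orb (@?f x) (@?g x))) =>
      apply: (@computable_or _ f g); computable_tac
  | |- computable _ (fun x => nat_of_bool (implb (@?f x) (@?g x))) =>
      apply: (@computable_imply _ f g); computable_tac
  | |- computable _ (fun x => nat_of_bool (@?f x \in _)) =>
      apply: (@computable_oracle _ f); computable_tac
  | |- computable _ (fun x => count (@?p x) (iota 0 (@?f x))) =>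
      apply: (@computable_count _ p f); computable_tac
  | |- computable _ (fun x => nat_of_bool (all (@?p x) (iota 0 (@?f x)))) =>
      apply: (@computable_all _ p f); computable_tac
  | |- computable _ (fun x => nat_of_bool (has (@?p x) (iota 0 (@?f x)))) =>
      apply: (@computable_has _ p f); computable_tac
  | |- computable _ (fun x => find (@?p x) (iota 0 (@?f x))) =>
      apply: (@computable_find _ p f); computable_tac
  | H : computable _ ?f |- computable _ (fun x => ?f (@?g x)) =>
      apply: (computable_comp H); computable_tac
  | |- _ => try exact: computable_cst
  end.

(** [CMu] searches for a zero, hence the program tests [~~ p]. The equivalence also settles
    divergence: without a witness there is no output. *)
Lemma computable_mu Y (p : nat -> nat -> bool) :
  computable Y (fun z => p (cleft z) (cright z)) ->
  exists c, forall x y, eval Y c x y <-> p x y /\ forall m, m < y -> ~~ p x m.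
Proof.
move=> /computable_neg[c cP]; exists (CMu c) => x y /=.
have evalE m : eval Y c (cpair x m) (~~ p x m).
  by have := cP (cpair x m); rewrite cleftK crightK.
split=> [[y0 mP]|[py mP]].
  split=> [|m /mP[k /(eval_inj (evalE m))]]; last by case: (p x m).
  by have := eval_inj (evalE y) y0; case: (p x y).
split=> [|m /mP npm]; first by have := evalE y; rewrite py.
by exists 0; have := evalE m; rewrite npm.
Qed.

(** * Bounded simulation of oracle programs *)

(* [sim O t c x] is y.+1 if c halts on x with output y, asking O only about
   numbers below t and searching below t only, and 0 otherwise. *)
Fixpoint sim (O : nat -> bool) (t : nat) (c : code) (x : nat) : nat :=
  match c with
  | CZero => 1
  | CSucc => x.+2
  | CLeft => (cleft x).+1
  | CRight => (cright x).+1
  | COracle => if x < t then (O x).+1 else 0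
  | CPair f g =>
      if (0 < sim O t f x) && (0 < sim O t g x)
      then (cpair (sim O t f x).-1 (sim O t g x).-1).+1 else 0
  | CComp f g =>
      if 0 < sim O t g x then sim O t f (sim O t g x).-1 else 0
  | CPrec f g =>
      nat_rec (fun=> nat) (sim O t f (cleft x))
        (fun n r => if 0 < r
           then sim O t g (cpair (cleft x) (cpair n r.-1)) else 0) (cright x)
  | CMu f =>
      if (find (fun m => sim O t f (cpair x m) <= 1) (iota 0 t) < t) &&
         (sim O t f
           (cpair x
             (find (fun m => sim O t f (cpair x m) <= 1) (iota 0 t))) == 1)
      then (find (fun m => sim O t f (cpair x m) <= 1) (iota 0 t)).+1 else 0
  end.

(** The program [c] is fixed, so induction on [c] suffices and no universal machine is built. The
    simulated oracle is finite and passed as a number. *)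
Lemma computable_sim Y c fe ft fx :
  computable Y fe -> computable Y ft -> computable Y fx ->
  computable Y (fun z => sim (bit (fe z)) (ft z) c (fx z)).
Proof.
elim: c fe ft fx => /=.
1-5: by move=> fe ft fx feP ftP fxP; computable_tac.
- move=> f IHf g IHg fe ft fx feP ftP fxP.
  by computable_tac; [exact: IHf|exact: IHg|exact: IHf|exact: IHg].
- move=> f IHf g IHg fe ft fx feP ftP fxP.
  by computable_tac; [exact: IHg|apply: IHf => //; computable_tac; exact: IHg].
- move=> f IHf g IHg fe ft fx feP ftP fxP.
  (* The recursion inside [sim] runs with [z] as parameter; [u] packs [z], the counter and the
     previous value. *)
  apply: (computable_rec
    (r := fun z n => nat_rec (fun=> nat)
       (sim (bit (fe z)) (ft z) f (cleft (fx z)))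
       (fun n r => if 0 < r then sim (bit (fe z)) (ft z) g
          (cpair (cleft (fx z)) (cpair n r.-1)) else 0) n)
    (f := fun z => sim (bit (fe z)) (ft z) f (cleft (fx z)))
    (g := fun u => let z := cleft u in let n := cleft (cright u) in
       let r := cright (cright u) in
       if 0 < r then sim (bit (fe z)) (ft z) g
         (cpair (cleft (fx z)) (cpair n r.-1)) else 0)) => [//|x n||/=|].
  + by rewrite /= !crightK !cleftK.
  + by apply: IHf => //; computable_tac.
  + by computable_tac; apply: IHg; computable_tac.
  + by computable_tac.
- move=> f IHf fe ft fx feP ftP fxP.
  by computable_tac; apply: (IHf); computable_tac; apply: (IHf); computable_tac.
Qed.

Lemma find_iotaP (p : pred nat) t n :
  find p (iota 0 t) = n -> n < t -> p n /\ forall m, m < n -> ~~ p m.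
Proof.
move=> fn nt; have hp : has p (iota 0 t) by rewrite has_find fn size_iota.
have := nth_find 0 hp; rewrite fn nth_iota // => pn; split=> // m mn.
have := @before_find _ 0 p (iota 0 t) m.
by rewrite fn => /(_ mn); rewrite nth_iota ?(ltn_trans mn) // add0n => ->.
Qed.

Lemma find_iotaE (p : pred nat) t n :
  n < t -> p n -> (forall m, m < n -> ~~ p m) -> find p (iota 0 t) = n.
Proof.
move=> nt pn nP; set f := find _ _.
have ft : f < t.
  rewrite -[t](size_iota 0) -has_find; apply/hasP; exists n => //.
  by rewrite mem_iota.
have [pf fP] := find_iotaP erefl ft.
case: (ltngtP f n) => // h; first by rewrite (negPf (nP _ h)) in pf.
by have := fP _ h; rewrite pn.
Qed.

(** A simulation that succeeds within [t] has used only oracle answers and searches below [t], so it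
    is unaffected by a larger bound or by changes of the oracle from [t] on. *)
Lemma sim_mono (O O' : nat -> bool) t t' c x :
  t <= t' -> (forall q, q < t -> O q = O' q) ->
  0 < sim O t c x -> sim O' t' c x = sim O t c x.
Proof.
move=> tt' OO'; elim: c x => //=.
- move=> x; case: (ltnP x t) => // xt _.
  by rewrite (leq_trans xt tt') OO'.
- move=> f IHf g IHg x; case: ifP => // /andP[f0 g0] _.
  by rewrite IHf // IHg // f0 g0.
- move=> f IHf g IHg x; case: ifP => // g0 f0.
  by rewrite IHg // g0 IHf.
- move=> f IHf g IHg x; elim: (cright x) => /= [|n IHn]; first exact: IHf.
  by case: ifP => // r0 g0; rewrite IHn // r0 IHg.
- move=> f IHf x; case: ifP => // /andP[ft /eqP f1] _.
  set n := find _ (iota 0 t) in ft f1 *.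
  have [_ nP] := find_iotaP erefl ft.
  (* Up to the found zero [n] all values of [sim] are positive (1 at [n], larger before), so the
     induction hypothesis applies to each. *)
  have e m : m <= n -> sim O' t' f (cpair x m) = sim O t f (cpair x m).
    rewrite leq_eqVlt => /orP[/eqP->|/nP m1]; apply: IHf; first by rewrite f1.
    by rewrite -ltnNge in m1; exact: ltnW.
  have -> : find (fun m => sim O' t' f (cpair x m) <= 1) (iota 0 t') = n.
    apply: find_iotaE => [||m mn]; first exact: leq_trans tt'.
      by rewrite e // f1.
    by rewrite e ?(ltnW mn) //; exact: nP.
  by rewrite (leq_trans ft tt') e // f1.
Qed.

Lemma sim_complete (Y : set nat) c x y :
  eval Y c x y -> exists t, sim (fun q => q \in Y) t c x = y.+1.
Proof.
set O := fun q => q \in Y.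
have mono t t' d z u : t <= t' -> sim O t d z = u.+1 -> sim O t' d z = u.+1.
  by move=> tt' e; rewrite (@sim_mono O O t t') ?e.
elim: c x y => /=; try by move=> x y ->; exists 0.
- by move=> x y ->; exists x.+1; rewrite ltnSn.
- move=> f IHf g IHg x y [a [b [/IHf[t1 e1] /IHg[t2 e2] ->]]].
  exists (maxn t1 t2).
  by rewrite (mono _ _ _ _ _ (leq_maxl _ _) e1)
    (mono _ _ _ _ _ (leq_maxr _ _) e2).
- move=> f IHf g IHg x y [z /IHg[t1 e1] /IHf[t2 e2]].
  exists (maxn t1 t2).
  by rewrite (mono _ _ _ _ _ (leq_maxl _ _) e1) /=
    (mono _ _ _ _ _ (leq_maxr _ _) e2).
- move=> f IHf g IHg x; rewrite -/(cleft x) -/(cright x).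
  elim: (cright x) => /= [|n IHn] y; first exact: IHf.
  move=> [m /IHn[t1 e1] /IHg[t2 e2]]; exists (maxn t1 t2).
  set r := nat_rec _ _ _ _.
  suff -> : r = m.+1 by rewrite /= (mono _ _ _ _ _ (leq_maxr _ _) e2).
  (* The recursion up to [n] is itself a run of [CPrec f g], so monotonicity carries it to the
     larger bound. *)
  have m' := @mono _ _ (CPrec f g) (cpair (cleft x) n) m (leq_maxl t1 t2).
  by move: m'; rewrite /= cleftK crightK; apply.
- move=> f IHf x y [/IHf[t0 e0] yP].
  have [t1 t1P] : exists t, forall m, m < y -> 1 < sim O t f (cpair x m).
    elim: y {e0} yP => [|y IHy] yP; first by exists 0.
    have [m my|t1 t1P] := IHy; first by apply: yP; exact: ltnW.
    have [k /IHf[t2 e2]] := yP y (ltnSn y); exists (maxn t1 t2) => m.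
    rewrite ltnS leq_eqVlt => /orP[/eqP->|/t1P h].
      by rewrite (mono _ _ _ _ _ (leq_maxr _ _) e2).
    by rewrite (sim_mono (leq_maxl t1 t2) _ (ltnW h)).
  (* Large enough for the zero at [y], for all earlier values, and for the search range to contain
     [y]. *)
  pose t := maxn (maxn t0 t1) y.+1; exists t.
  have s0 : sim O t f (cpair x y) = 1 by apply: mono e0; rewrite /t; lia.
  have yt : y < t by rewrite /t; lia.
  have -> : find (fun m => sim O t f (cpair x m) <= 1) (iota 0 t) = y.
    apply: find_iotaE => // [|m /t1P h]; first by rewrite s0.
    rewrite -ltnNge (@sim_mono O O t1 t f (cpair x m)) ?(ltnW h) //.
    by rewrite /t; lia.
  by rewrite s0 yt.
Qed.

(** * Numbers as finite sets *)

Fixpoint of_bits (f : nat -> bool) (t : nat) : nat :=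
  if t is t'.+1 then f 0 + 2 * of_bits (f \o succn) t' else 0.

Lemma bitS e n : bit e n.+1 = bit e./2 n.
Proof. by rewrite /bit iterSr. Qed.

Lemma bit0n n : bit 0 n = false.
Proof. by elim: n => // n; rewrite bitS. Qed.

Lemma bit_of_bits f t n : bit (of_bits f t) n = (n < t) && f n.
Proof.
elim: t f n => [|t IHt] f [|n] /=; rewrite ?bit0n //.
  by rewrite /bit /=; case: (f 0); lia.
rewrite bitS ltnS -[RHS]/((n < t) && (f \o succn) n) -IHt; congr bit.
by case: (f 0); lia.
Qed.

Lemma of_bits_lt f t : of_bits f t < 2 ^ t.
Proof.
elim: t f => // t IHt f /=; rewrite expnS.
by have := IHt (f \o succn); case: (f 0); lia.
Qed.

Lemma bit_ge e t n : e < 2 ^ t -> t <= n -> bit e n = false.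
Proof.
elim: t e n => [|t IHt] e [|n]; rewrite ?expn0 ?ltnS ?leqn0.
- by move=> /eqP->.
- by move=> /eqP-> _; rewrite bit0n.
- by [].
by rewrite bitS expnS => h tn; apply: IHt => //; lia.
Qed.

Lemma bit_exists e t : 0 < e -> e < 2 ^ t -> exists2 n, n < t & bit e n.
Proof.
elim: t e => [|t IHt] e e0; first by rewrite expn0; lia.
rewrite expnS => et; have [eo|eo] := boolP (odd e); first by exists 0.
have [n nt bn] : exists2 n, n < t & bit e./2 n by apply: IHt; lia.
by exists n.+1 => //; rewrite bitS.
Qed.

Lemma bit_add_exp w s n : w < 2 ^ s -> bit (w + 2 ^ s) n = (n == s) || bit w n.
Proof.
elim: s w n => [|s IHs] w [|n].
- by rewrite expn0 ltnS leqn0 => /eqP->.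
- by rewrite expn0 ltnS leqn0 => /eqP->; rewrite bitS /= !bit0n.
- by move=> _; rewrite /bit /= oddD oddX /= addbF.
rewrite expnS !bitS eqSS => ws; rewrite -IHs; last lia.
by congr bit; lia.
Qed.

Lemma bit_exp a n : bit (2 ^ a) n = (n == a).
Proof. by rewrite -[2 ^ a]add0n bit_add_exp ?expn_gt0 // bit0n orbF. Qed.

Lemma leq_count_iota (P Q : pred nat) t t' :
  t <= t' -> (forall v, v < t -> P v -> Q v) ->
  count P (iota 0 t) <= count Q (iota 0 t').
Proof.
move=> tt' PQ; rewrite -(subnKC tt') iotaD count_cat.
apply: leq_trans (leq_addr _ _).
rewrite -!size_filter; apply: uniq_leq_size.
  by rewrite filter_uniq ?iota_uniq.
by move=> v; rewrite !mem_filter mem_iota /= => /andP[Pv vt]; rewrite PQ.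
Qed.

Lemma all_iotaP (p : pred nat) t :
  reflect (forall n, n < t -> p n) (all p (iota 0 t)).
Proof.
apply: (iffP allP) => [h n nt|h n]; first by apply: h; rewrite mem_iota.
by rewrite mem_iota /= add0n => /h.
Qed.

(** Koenig's lemma for the binary tree: the branch is built bit by bit, keeping every prefix
    extendible to a solution at each level. *)
Lemma konig (P : nat -> (nat -> bool) -> Prop) (bd : nat -> nat) :
  (forall t B B', (forall n, n < bd t -> B n = B' n) -> P t B -> P t B') ->
  (forall t t' B, t <= t' -> P t' B -> P t B) ->
  (forall t, exists B, P t B) -> exists B, forall t, P t B.
Proof.
move=> Pext Pmono Pex.
pose extendible (s : seq bool) := forall t, exists B,
  (forall i, i < size s -> B i = nth false s i) /\ P t B.
have step s : extendible s -> ~ extendible (rcons s true) ->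
    extendible (rcons s false).
  move=> sP /existsNP[t1 t1P] t2.
  have [B [Bs PB]] := sP (maxn t1 t2); exists B.
  have PBle u : u <= maxn t1 t2 -> P u B by move=> /Pmono; exact.
  split; last by apply: PBle; exact: leq_maxr.
  have BsE b : B (size s) = b ->
      forall i, i < size (rcons s b) -> B i = nth false (rcons s b) i.
    move=> Bb i; rewrite size_rcons ltnS leq_eqVlt nth_rcons.
    move=> /orP[/eqP->|is_].
      by rewrite ltnn eqxx.
    by rewrite is_; exact: Bs.
  case Bsz : (B (size s)); last exact: BsE.
  case: t1P; exists B; split; first exact: BsE.
  by apply: PBle; exact: leq_maxl.
pose next s := rcons s `[< extendible (rcons s true) >].
pose S n := iter n next [::].
have SP n : extendible (S n) /\ size (S n) = n.
  elim: n => [|n [IHn sz]]; first split=> // t.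
    by have [B PB] := Pex t; exists B.
  rewrite /S iterS -/(S n) /next size_rcons sz; split=> //.
  by case: asboolP => // /(step _ IHn).
exists (fun n => nth false (S n.+1) n) => t.
have [/(_ t)[B [BS PB]] sz] := SP (bd t); apply: Pext PB => n nt.
rewrite BS ?sz // -(subnKC nt); elim: (bd t - n.+1) => [|d IHd].
  by rewrite addn0.
rewrite addnS /S iterS -/(S (n.+1 + d)) /next nth_rcons (SP _).2.
by rewrite leq_addr.
Qed.

(** * The condition queried by the enumeration *)

Section Sat.
Variables (U : code) (k j : nat).

(** This is L_E of the overview for [O := bit E]. The numbers below 2^(k+1) include those of all
    strings of length at most k. *)
Definition listed (O : nat -> bool) (t v : nat) : bool :=
  has (fun p => sim O t U p == v.+1) (iota 0 (2 ^ k.+1)).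

(** Membership of [v] in L_E U {v : E <= B_v}; in [sat] all elements of E are below [t], so the
    bounded test loses nothing. *)
Definition covered (B : nat -> bool) (t E v : nat) : bool :=
  listed (bit E) t v || all (fun a => bit E a ==> B (cpair v a)) (iota 0 t).

(* W is the set of accepted pairs n = <v, M>, and B encodes the sets B_v by
   pairs <v, a> with a in B_v.  The bounds depending on t make this decidable
   and decreasing in t. *)
Definition sat (W B : nat -> bool) (t : nat) : bool :=
  all (fun n => W n ==> all (fun m => (cright n <= m) ==>
     (m <= 2 ^ j * count (fun a => B (cpair (cleft n) a)) (iota 0 m)))
     (iota 0 t.+1)) (iota 0 t) &&
  all (fun E => (0 < E) ==> (count (covered B t E) (iota 0 t) <= 2 ^ k.+1))
    (iota 0 (2 ^ t)).

Lemma sat_spec (W B : nat -> bool) t : reflect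
  ((forall n m, n < t -> m <= t -> W n -> cright n <= m ->
     m <= 2 ^ j * count (fun a => B (cpair (cleft n) a)) (iota 0 m)) /\
   forall E, 0 < E -> E < 2 ^ t -> count (covered B t E) (iota 0 t) <= 2 ^ k.+1)
  (sat W B t).
Proof.
apply: (iffP andP) => [[/all_iotaP h1 /all_iotaP h2]|[h1 h2]].
  split=> [n m nt mt Wn|E E0 Et]; last by have := h2 E Et; rewrite E0.
  by have /implyP/(_ Wn)/all_iotaP/(_ m mt)/implyP := h1 n nt.
split; apply/all_iotaP; last by move=> E Et; apply/implyP => /h2; apply.
move=> n nt; apply/implyP => Wn; apply/all_iotaP => m mt.
by apply/implyP; exact: h1.
Qed.

Lemma listed_mono O O' t t' v : t <= t' -> (forall q, q < t -> O q = O' q) ->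
  listed O t v -> listed O' t' v.
Proof.
move=> tt' OO' /hasP[p pk /eqP e]; apply/hasP; exists p => //.
by rewrite (sim_mono tt' OO') e.
Qed.

Lemma count_listed O t t' : count (listed O t) (iota 0 t') <= 2 ^ k.+1.
Proof.
rewrite -[leqRHS](size_iota 0) -(size_map (fun p => (sim O t U p).-1)).
rewrite -size_filter.
apply: uniq_leq_size; first by rewrite filter_uniq ?iota_uniq.
move=> v; rewrite mem_filter => /andP[/hasP[p pk /eqP e] _].
by apply/mapP; exists p => //; rewrite e.
Qed.

(** Every constraint at level [t] recurs at level [t'], where the count of covered numbers can only
    be larger; level [t] reads [B] below [cpair t t] only. *)
Lemma sat_mono (W W' B B' : nat -> bool) t t' :
  t <= t' -> (forall n, n < t -> W n = W' n) ->
  (forall n, n < cpair t t -> B n = B' n) -> sat W' B' t' -> sat W B t.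
Proof.
move=> tt' WW' BB' /sat_spec[D C]; apply/sat_spec; split=> [n m nt mt|E E0 Et].
  rewrite (WW' _ nt) => Wn nm.
  apply: leq_trans (D n m (leq_trans nt tt') (leq_trans mt tt') Wn nm) _.
  rewrite leq_mul2l; apply/orP; right; apply: leq_count_iota => // a am.
  rewrite BB' //; apply: ltn_cpair; last exact: leq_trans mt.
  exact: leq_ltn_trans (leq_cleft n) nt.
have Et' : E < 2 ^ t' by apply: leq_trans Et _; rewrite leq_exp2l.
apply: leq_trans (C E E0 Et'); apply: leq_count_iota => // v vt.
move=> /orP[l|/all_iotaP a].
  by rewrite /covered (@listed_mono (bit E) (bit E) t).
apply/orP; right; apply/all_iotaP => b bt'; apply/implyP => Eb.
have bt : b < t by rewrite ltnNge; apply/negP => /(bit_ge Et); rewrite Eb.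
by rewrite -BB' ?ltn_cpair //; apply: (implyP (a b bt)).
Qed.

(** The quantifiers stand in this order so that failure is semidecidable; compactness then yields
    one [B] for all levels. *)
Definition satisfiable W := forall t, exists B, sat W B t.

Lemma satisfiable_compact W : satisfiable W -> exists B, forall t, sat W B t.
Proof.
apply: (@konig (fun t B => sat W B t) (fun t => cpair t t))
  => [t B B' BB'|t t' B tt'].
  by apply: sat_mono => // n nt; rewrite BB'.
exact: sat_mono.
Qed.

Lemma satisfiable_ext W W' : W =1 W' -> satisfiable W -> satisfiable W'.
Proof. by move=> e h t; have [B BP] := h t; exists B; apply: sat_mono BP. Qed.

(** With all B_v empty, a nonempty E covers listed numbers only. *)
Lemma satisfiable_none : satisfiable (fun=> false).
Proof.
move=> t; exists (fun=> false); apply/sat_spec; split=> // E E0 Et.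
apply: leq_trans (count_listed (bit E) t t); apply: leq_count_iota => // v vt.
move=> /orP[//|/all_iotaP h]; have [n nt En] := bit_exists E0 Et.
by have := h n nt; rewrite En.
Qed.

End Sat.

(** * Bounding and extending the set of accepted candidates *)

Lemma count_sum (T : Type) (p : pred T) s : count p s = \sum_(a <- s) p a.
Proof. by elim: s => [|a s IHs]; rewrite ?big_nil // big_cons -IHs. Qed.

Definition unbounded (Y : set nat) := forall N, exists2 n, N <= n & Y n.

Section Card.
Variables (U : code) (k j : nat).
Implicit Types W B : nat -> bool.

(** Double counting of the pairs (v, a) with a in B_v and a <= s: each B_v holds at least a 2^-j
    fraction of [0, s], and each a lies in at most 2^(k+1) of the sets. *)
Lemma sat_card W B s : (forall t, sat U k j W B t) ->
  (forall n m, n < s -> m < s -> W n -> W m -> cleft n = cleft m -> n = m) ->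
  count W (iota 0 s) <= 2 ^ (k.+1 + j).
Proof.
move=> /(_ s.+1)/sat_spec[D C] Winj; set r := [seq n <- iota 0 s | W n].
have rP n : n \in r -> n < s /\ W n.
  by rewrite mem_filter mem_iota /= add0n => /andP[].
have ur : uniq r by rewrite filter_uniq ?iota_uniq.
rewrite -size_filter -/r -(leq_pmul2r (ltn0Sn s)).
apply: (@leq_trans (2 ^ j * \sum_(n <- r)
    count (fun a => B (cpair (cleft n) a)) (iota 0 s.+1))).
  rewrite -sum1_size big_distrl big_distrr /= big_seq [leqRHS]big_seq.
  apply: leq_sum => n /rP[ns Wn]; rewrite mul1n; apply: D => //.
    exact: ltnW.
  by apply: leq_trans (leq_cright n) _; lia.
rewrite addnC expnD -mulnA leq_mul2l; apply/orP; right.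
under eq_bigr do rewrite count_sum.
rewrite exchange_big.
apply: (@leq_trans (\sum_(a <- iota 0 s.+1) 2 ^ k.+1)); last first.
  by rewrite big_const_seq count_predT size_iota iter_addn_0.
rewrite big_seq [leqRHS]big_seq; apply: leq_sum => a.
rewrite mem_iota /= add0n => as_; rewrite -count_sum.
(* The singleton E = {a} has the number 2^a. *)
apply: leq_trans (C (2 ^ a) _ _); rewrite ?expn_gt0 ?ltn_exp2l //.
rewrite -!size_filter -(size_map cleft); apply: uniq_leq_size.
  rewrite map_inj_in_uniq ?filter_uniq ?iota_uniq // => n m.
  rewrite mem_filter => /andP[_ /rP[ns Wn]].
  by rewrite mem_filter => /andP[_ /rP[ms Wm]]; exact: Winj.
move=> _ /mapP[n + ->]; rewrite mem_filter => /andP[Bn /rP[ns _]].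
rewrite mem_filter mem_iota /= add0n; apply/andP; split; last first.
  by apply: leq_ltn_trans (leq_cleft n) _; lia.
apply/orP; right; apply/all_iotaP => b _; rewrite bit_exp.
by apply/implyP => /eqP->.
Qed.

(** The threshold [M] depends on [W] and [A] but not on [s], so the candidate may be chosen as late
    as desired. *)
Lemma satisfiable_add W s0 (A : set nat) v0 :
  (forall n, W n -> n < s0) -> (forall n, W n -> cleft n <> v0) ->
  satisfiable U k j W ->
  (forall Y, Y `<=` A -> unbounded Y ->
    exists2 p, p < 2 ^ k.+1 & eval Y U p v0) ->
  (forall N, exists M, forall m, M <= m ->
    m <= 2 ^ j * count (fun a => (a \in A) && (N <= a)) (iota 0 m)) ->
  exists M, forall s, cleft s = v0 -> M <= cright s ->
    satisfiable U k j (fun n => (n == s) || W n).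
Proof.
move=> Ws0 Wv0 /satisfiable_compact[B BP] Av0 Ad.
pose Q (S : {set 'I_s0}) : set nat :=
  [set x | x \in A /\ forall v, v \in S -> B (cpair v x)].
(* [N S] lies beyond all elements of [Q S] when that intersection is finite, so one element from
   [N S] on proves it infinite. *)
have /choice[N NP] (S : {set 'I_s0}) :
    exists N, (exists2 x, N <= x & Q S x) -> unbounded (Q S).
  have [h|/existsNP[N NP]] := pselect (unbounded (Q S)); first by exists 0.
  by exists N => h; case: NP.
pose N0 := \max_(S : {set 'I_s0}) N S.
have [M MP] := Ad N0; exists M => s sv0 Ms t.
(* The sets B_v with v >= [s0], v <> [v0], are emptied: no accepted pair concerns them, and only the
   finitely many intersections [Q S] then matter. *)
pose B' x := if cleft x == v0 then (cright x \in A) && (N0 <= cright x)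
             else B x && (cleft x < s0).
exists B'; have [D C] := sat_spec _ _ _ _ _ _ (BP t); apply/sat_spec; split.
  move=> n m nt mt /orP[/eqP->|Wn] nm.
    rewrite sv0; apply: leq_trans (MP m (leq_trans Ms nm)) _.
    rewrite leq_mul2l; apply/orP; right; apply: leq_count_iota => // a _.
    by rewrite /B' cleftK crightK eqxx.
  apply: leq_trans (D n m nt mt Wn nm) _.
  rewrite leq_mul2l; apply/orP; right; apply: leq_count_iota => // a _ Ba.
  rewrite /B' cleftK; case: eqP => [e|_]; first by have := Wv0 _ Wn e.
  by rewrite Ba; apply: leq_ltn_trans (leq_cleft n) (Ws0 _ Wn).
move=> E E0 Et; have [x xt Ex] := bit_exists E0 Et.
(* If E is not inside the new set for [v0], then every [v] covered now was covered under [B], and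
   the old bound applies. *)
have [/all_iotaP EA|EA] := boolP (all
    (fun a => bit E a ==> (a \in A) && (N0 <= a)) (iota 0 t)); last first.
  apply: leq_trans (C E E0 Et); apply: leq_count_iota => // v vt.
  move=> /orP[l|/all_iotaP a]; apply/orP; first by left.
  right; apply/all_iotaP => b bt; apply/implyP => Eb.
  have := implyP (a b bt) Eb; rewrite /B' cleftK; case: eqP => [e|_].
  2: by case/andP.
  case/negP: EA; apply/all_iotaP => c ct; apply/implyP => Ec.
  by have := implyP (a c ct) Ec; rewrite /B' cleftK crightK e eqxx.
pose S := [set v : 'I_s0 |
  all (fun a => bit E a ==> B (cpair v a)) (iota 0 t)]%SET.
have SP (v : 'I_s0) a : v \in S -> a < t -> bit E a -> B (cpair v a).
  by rewrite inE => /all_iotaP h /h/implyP.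
have Qu : unbounded (Q S).
  have /andP[xA Nx] := implyP (EA x xt) Ex.
  apply: NP; exists x; first by apply: leq_trans Nx; exact: leq_bigmax.
  by split=> // v vS; exact: SP.
(* [Y] prolongs E from [t] on inside [Q S]; it is an infinite subset of [A], so some short program
   prints [v0] with oracle [Y]. *)
pose Y : set nat := [set a | bit E a \/ t <= a /\ Q S a].
have Elt a : bit E a -> a < t.
  by move=> Ea; rewrite ltnNge; apply/negP => /(bit_ge Et); rewrite Ea.
have [p pk /sim_complete[t1 simv0]] : exists2 p, p < 2 ^ k.+1 & eval Y U p v0.
  apply: Av0.
    move=> a [Ea|[_ [/set_mem//]]].
    by have /andP[/set_mem] := implyP (EA a (Elt _ Ea)) Ea.
  move=> n; have [m nm Qm] := Qu (maxn n t); exists m; first by lia.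
  by right; split=> //; lia.
(* The initial segment F of [Y] is long enough to agree with E below [t], to complete the run
   printing [v0], and to have [v0] counted. *)
pose t' := maxn (maxn t t1) v0.+1; pose F := of_bits (fun a => a \in Y) t'.
have FE a : bit F a = (a < t') && (a \in Y) by exact: bit_of_bits.
have tt' : t <= t' by rewrite /t'; lia.
have EF q : q < t -> bit E q = bit F q.
  move=> qt; rewrite FE (leq_trans qt tt') /=.
  apply/idP/idP => [Eq|/set_mem[//|[]]]; first by apply/mem_set; left.
  by rewrite leqNgt qt.
have F0 : 0 < F.
  by rewrite lt0n; apply/eqP => F0; have := EF x xt; rewrite F0 bit0n Ex.
have [_ C'] := sat_spec _ _ _ _ _ _ (BP t').
apply: leq_trans (C' F F0 (of_bits_lt _ _)); apply: leq_count_iota => // v vt.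
(* All that E covers under [B'] is covered by F under [B]: numbers listed by E stay listed, [v0] is
   listed by F, and any other [v] is in [S], so that F <= B_v. *)
move=> /orP[l|/all_iotaP a]; apply/orP; first by left; exact: listed_mono l.
have [vv0|vv0] := eqVneq v v0.
  left; apply/hasP; exists p; first by rewrite mem_iota.
  rewrite vv0 -simv0; apply/eqP; apply: sim_mono; rewrite ?simv0 //.
    by rewrite /t'; lia.
  by move=> q qt1; rewrite FE (_ : q < t') //; rewrite /t'; lia.
have aB b : b < t -> bit E b -> B (cpair v b) && (v < s0).
  by move=> bt Eb; have := implyP (a b bt) Eb; rewrite /B' cleftK (negPf vv0).
have /andP[_ vs0] := aB x xt Ex.
have vS : Ordinal vs0 \in S.
  rewrite inE; apply/all_iotaP => b bt; apply/implyP => Eb.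
  by have /andP[] := aB b bt Eb.
right; apply/all_iotaP => b bt'; apply/implyP; rewrite FE bt' => /set_mem.
case=> [Eb|[_ [_ /(_ _ vS)//]]].
by have /andP[] := aB b (Elt _ Eb) Eb.
Qed.

(** * The enumeration of candidates *)

(** Stage s' decides on the pair <v, M> with number s', given the set accepted so far, and records
    acceptance as the binary digit s'. *)
Fixpoint enumeration (acc : nat -> nat -> bool) (s : nat) : nat :=
  if s is s'.+1
  then enumeration acc s' + acc s' (enumeration acc s') * 2 ^ s' else 0.

(** Allows one threshold per value v, as the counting bound needs distinct values. *)
Definition fresh (s w : nat) : bool :=
  ~~ has (fun n => bit w n && (cleft n == cleft s)) (iota 0 s).

Section Enumeration.
Variable acc : nat -> nat -> bool.
Local Notation enum := (enumeration acc).
Definition accepted (s : nat) : bool := acc s (enum s).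

Lemma enumeration_lt s : enum s < 2 ^ s.
Proof. by elim: s => //= s IHs; rewrite expnS; case: (acc _ _); lia. Qed.

Lemma bit_enumeration s n : bit (enum s) n = (n < s) && accepted n.
Proof.
elim: s => [|s IHs] /=; first by rewrite bit0n.
rewrite -/(accepted s) ltnS leq_eqVlt; case as_ : (accepted s).
  by rewrite mul1n bit_add_exp ?enumeration_lt // IHs; case: eqP => // ->.
by rewrite mul0n addn0 IHs; case: eqP => // ->; rewrite ltnn as_.
Qed.

Hypothesis accP : forall s w,
  acc s w <-> fresh s w /\ satisfiable U k j (bit (w + 2 ^ s)).

Lemma enumeration_satisfiable s : satisfiable U k j (bit (enum s)).
Proof.
elim: s => [|s IHs] /=.
  by apply: satisfiable_ext (satisfiable_none U k j) => n; rewrite bit0n.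
case h : (acc s (enum s)); last by rewrite mul0n addn0.
by move/accP : h => []; rewrite mul1n.
Qed.

Lemma accepted_inj n m :
  accepted n -> accepted m -> cleft n = cleft m -> n = m.
Proof.
wlog nm : n m / n <= m => [th an am e|an /accP[/hasPn h _] e].
  by case: (leqP n m) => [|/ltnW] /th->.
move: nm; rewrite leq_eqVlt => /orP[/eqP//|nm].
have := h n; rewrite mem_iota nm => /(_ isT).
by rewrite bit_enumeration nm an e eqxx.
Qed.

Lemma count_accepted s : count accepted (iota 0 s) <= 2 ^ (k.+1 + j).
Proof.
have [B BP] := satisfiable_compact (@enumeration_satisfiable s).
apply: leq_trans (sat_card BP (s := s) _).
  by apply: leq_count_iota => // n ns; rewrite bit_enumeration ns.
move=> n m ns ms; rewrite !bit_enumeration => /andP[_ an] /andP[_ am].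
exact: accepted_inj.
Qed.

(** The number of acceptances is bounded, and nothing is accepted once it has reached its
    maximum. *)
Lemma accepted_stable : exists s0, forall s, s0 <= s -> ~~ accepted s.
Proof.
have ex : exists n, `[< exists s, count accepted (iota 0 s) = n >].
  by exists 0; apply/asboolP; exists 0.
have bd n : `[< exists s, count accepted (iota 0 s) = n >] ->
    n <= 2 ^ (k.+1 + j).
  by move=> /asboolP[s <-]; exact: count_accepted.
have [n /asboolP[s0 <-] nP] := ex_maxnP ex bd.
exists s0 => s s0s; apply/negP => as_.
have /nP : `[< exists s', count accepted (iota 0 s') =
    count accepted (iota 0 s.+1) >].
  by apply/asboolP; exists s.+1.
rewrite -addn1 iotaD count_cat /= add0n as_ addn0 addn1 ltnNge.
by rewrite leq_count_iota.
Qed.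

Lemma accepted_complete (A : set nat) v0 :
  (forall Y, Y `<=` A -> unbounded Y ->
    exists2 p, p < 2 ^ k.+1 & eval Y U p v0) ->
  (forall N, exists M, forall m, M <= m ->
    m <= 2 ^ j * count (fun a => (a \in A) && (N <= a)) (iota 0 m)) ->
  exists s, [/\ accepted s, cleft s = v0 &
    count accepted (iota 0 s) < 2 ^ (k.+1 + j)].
Proof.
move=> Av0 Ad.
have [[s [as_ sv0]]|nex] := pselect (exists s, accepted s /\ cleft s = v0).
  exists s; split=> //; apply: leq_trans (count_accepted s.+1).
  by rewrite -[s.+1]addn1 iotaD count_cat /= add0n as_ addn0 addn1.
have [s0 s0P] := accepted_stable.
have Wn0 n : bit (enum s0) n -> n < s0 /\ accepted n.
  by rewrite bit_enumeration => /andP[].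
have [n /Wn0[]//|n /Wn0[_ an] e||M MP] :=
  @satisfiable_add (bit (enum s0)) s0 A v0 _ _ _ Av0 Ad.
- by apply: nex; exists n.
- exact: enumeration_satisfiable.
(* A threshold of at least [s0] puts the stage [s] after the last acceptance, yet [s] satisfies the
   criterion: a contradiction. *)
pose s := cpair v0 (maxn M s0).
have s0s : s0 <= s by apply: leq_trans (leq_cright s); rewrite crightK leq_maxr.
have eqW : bit (enum s) =1 bit (enum s0).
  move=> n; rewrite !bit_enumeration.
  case an : (accepted n); last by rewrite !andbF.
  rewrite !andbT; apply/idP/idP => [_|/leq_trans]; last exact.
  by rewrite ltnNge; apply/negP => /s0P; rewrite an.
case/negP: (s0P s s0s); apply/accP; split.
  apply/hasPn => n _; apply/negP => /andP[]; rewrite eqW => /Wn0[_ an] /eqP e.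
  by apply: nex; exists n; rewrite e cleftK.
apply: satisfiable_ext (MP s _ _); rewrite ?cleftK ?crightK ?leq_maxl // => n.
by rewrite bit_add_exp ?enumeration_lt // eqW.
Qed.

End Enumeration.
End Card.

(** * The machine with oracle 0' *)

(** Level [t] reads [B] below [cpair t t] only, so these finitely many [b] represent all [B]. *)
Definition refuted (U : code) (k j w t : nat) : bool :=
  all (fun b => ~~ sat U k j (bit w) (bit b) t) (iota 0 (2 ^ cpair t t)).

Lemma satisfiable_refuted U k j w :
  satisfiable U k j (bit w) <-> ~ exists t, refuted U k j w t.
Proof.
split=> [h [t /all_iotaP r]|r t].
  have [B BP] := h t; have := r _ (of_bits_lt B (cpair t t)).
  by case/negP; apply: sat_mono BP => // n nt; rewrite bit_of_bits nt.
apply: contrapT => nB; apply: r; exists t; apply/all_iotaP => b _.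
by apply/negP => bP; apply: nB; exists (bit b).
Qed.

Lemma computable_refuted Y U fk fj fw ft :
  computable Y fk -> computable Y fj -> computable Y fw -> computable Y ft ->
  computable Y (fun z => refuted U (fk z) (fj z) (fw z) (ft z)).
Proof.
move=> fkP fjP fwP ftP; rewrite /refuted /sat /covered /listed.
by computable_tac; apply: computable_sim; computable_tac.
Qed.

(** One oracle-free program serves all parameters, so satisfiability becomes a single question to
    0'. *)
Lemma refuter U : exists c, forall k j w,
  (exists y, eval set0 c (cpair w (cpair k j)) y) <->
  exists t, refuted U k j w t.
Proof.
have [|c cP] := @computable_mu set0 (fun x t =>
  refuted U (cleft (cright x)) (cright (cright x)) (cleft x) t).
  by apply: computable_refuted; computable_tac.
exists c => k j w; split=> [[y /cP[]]|tP].
  by rewrite !crightK !cleftK => h _; exists y.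
have [t tr tmin] := ex_minnP tP.
exists t; apply/cP; rewrite !crightK !cleftK; split=> // m mt.
by apply/negP => /tmin; rewrite leqNgt mt.
Qed.

Lemma halting_problemE c x :
  (cpair (code_num c) x \in halting_problem) <-> exists y, eval set0 c x y.
Proof.
split=> [/set_mem[c' [x' [y [/cpair_inj[/code_num_inj<- <-] h]]]]|[y h]].
  by exists y.
by apply/mem_set; exists c, x, y.
Qed.

(** For [h] the number of the program from [refuter], this accepts [s] when adding it to the set [w]
    is never refuted. *)
Definition acceptor (h k j s w : nat) : bool :=
  fresh s w && (cpair h (cpair (w + 2 ^ s) (cpair k j)) \notin halting_problem).

Lemma computable_enumeration h fk fj fs :
  let Y := halting_problem in
  computable Y fk -> computable Y fj -> computable Y fs ->
  computable Y (fun x => enumeration (acceptor h (fk x) (fj x)) (fs x)).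
Proof.
move=> Y fkP fjP fsP.
apply: (computable_rec
  (r := fun x n => enumeration (acceptor h (fk x) (fj x)) n) (f := fun=> 0)
  (g := fun u => cright (cright u) +
     acceptor h (fk (cleft u)) (fj (cleft u)) (cleft (cright u))
       (cright (cright u)) * 2 ^ cleft (cright u))) => [//|x n|||//].
- by rewrite !crightK !cleftK.
- exact: computable_cst.
- by rewrite /acceptor /fresh; computable_tac.
Qed.

(** * Encoding and decoding *)

(** In binary, from the low end: l zeros and a one, then j in l digits, then i in k+1+j digits, then
    a leading one whose position reveals k. Only l is written in unary, whence the cost 2l. *)
Definition encode (l j k i : nat) : nat :=
  2 ^ l * (2 * (2 ^ l * (2 ^ (k.+1 + j) + i) + j) + 1).

Lemma exp2_odd_inj l a l' a' :
  2 ^ l * (2 * a + 1) = 2 ^ l' * (2 * a' + 1) -> l = l' /\ a = a'.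
Proof.
elim: l l' => [|l IHl] [|l']; rewrite ?expn0 ?expnS -?mulnA; try lia.
by move=> e; have [|-> ->] := IHl l'; first lia.
Qed.

Lemma exp2_add_inj m i m' i' : i < 2 ^ m -> i' < 2 ^ m' ->
  2 ^ m + i = 2 ^ m' + i' -> m = m' /\ i = i'.
Proof.
move=> im im' e.
have lt a b : a < b -> 2 * 2 ^ a <= 2 ^ b.
  by move=> ab; rewrite -expnS leq_exp2l.
case: (ltngtP m m') => [/lt|/lt|mm']; try lia.
by split=> //; subst m'; lia.
Qed.

Lemma encode_inj l j k i l' j' k' i' :
  j < 2 ^ l -> i < 2 ^ (k.+1 + j) -> j' < 2 ^ l' -> i' < 2 ^ (k'.+1 + j') ->
  encode l j k i = encode l' j' k' i' -> [/\ j = j', k = k' & i = i'].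
Proof.
move=> jl ik jl' ik' /exp2_odd_inj[ll' e]; subst l'.
have ee (u v u' v' : nat) : v < 2 ^ l -> v' < 2 ^ l ->
    2 ^ l * u + v = 2 ^ l * u' + v' -> u = u' /\ v = v'.
  move=> vl vl' f; have l0 : 0 < 2 ^ l by rewrite expn_gt0.
  have := congr1 (divn^~ (2 ^ l)) f; have := congr1 (modn^~ (2 ^ l)) f.
  rewrite ![2 ^ l * _]mulnC !modnMDl !divnMDl // !divn_small // !modn_small //.
  by rewrite !addn0.
have [e1 jj'] := ee _ _ _ _ jl jl' e; subst j'.
have [e2 ->] := exp2_add_inj ik ik' e1.
by split=> //; lia.
Qed.

Lemma encode_lt l j k i : j < 2 ^ l -> i < 2 ^ (k.+1 + j) ->
  encode l j k i < 2 ^ (k + j + 2 * l + 3).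
Proof.
move=> jl ik; rewrite /encode.
have -> : k + j + 2 * l + 3 = l + (1 + (l + (1 + (k.+1 + j)))) by lia.
rewrite (expnD 2 l) ltn_pmul2l ?expn_gt0 // (expnD 2 1).
set X := 2 ^ (l + _).
suff : 2 ^ l * (2 ^ (k.+1 + j) + i) + j < X by lia.
rewrite /X (expnD 2 l) (expnD 2 1) expn1.
have : 2 ^ l * (2 ^ (k.+1 + j) + i).+1 <= 2 ^ l * (2 * 2 ^ (k.+1 + j)).
  by rewrite leq_mul2l; apply/orP; right; lia.
by rewrite mulnS; lia.
Qed.

Lemma count_accepted_inj acc s s' : accepted acc s -> accepted acc s' ->
  count (accepted acc) (iota 0 s) = count (accepted acc) (iota 0 s') -> s = s'.
Proof.
wlog ss' : s s' / s <= s' => [th a a' e|a _ e].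
  by case: (leqP s s') => [|/ltnW] /th->.
move: ss'; rewrite leq_eqVlt => /orP[/eqP//|ss'].
have := @leq_count_iota (accepted acc) (accepted acc) s.+1 s' ss'
  (fun _ _ h => h).
by rewrite -[s.+1]addn1 iotaD count_cat /= add0n a; lia.
Qed.

(** The machine searches for parameters matching its input and for the accepted stage of index [i];
    since [encode] and the index are injective, whatever it finds has the right stage. *)
Lemma decoder h : exists M, forall l j k s,
  let acc := acceptor h k j in
  let i := count (accepted acc) (iota 0 s) in
  j < 2 ^ l -> i < 2 ^ (k.+1 + j) -> accepted acc s ->
  eval halting_problem M (encode l j k i) (cleft s).
Proof.
pose zl z := cleft (cleft z); pose zj z := cright (cleft z).
pose zk z := cleft (cleft (cright z)); pose zi z := cright (cleft (cright z)).
pose zs z := cright (cright z).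
pose p n z :=
  [&& zj z < 2 ^ zl z, zi z < 2 ^ ((zk z).+1 + zj z),
      n == encode (zl z) (zj z) (zk z) (zi z),
      accepted (acceptor h (zk z) (zj z)) (zs z) &
      count (accepted (acceptor h (zk z) (zj z))) (iota 0 (zs z)) == zi z].
have [|c cP] := @computable_mu halting_problem p.
  rewrite /p /encode /accepted /acceptor /fresh /zl /zj /zk /zi /zs.
  by computable_tac; apply: computable_enumeration; computable_tac.
have [d dP] : computable halting_problem (fun z => cleft (zs z)).
  by rewrite /zs; computable_tac.
exists (CComp d c) => l j k s acc i jl ik as_ /=.
pose z0 := cpair (cpair l j) (cpair (cpair k i) s).
have pz0 : p (encode l j k i) z0.
  rewrite /p /zl /zj /zk /zi /zs /z0 !cleftK !crightK !cleftK !crightK.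
  by rewrite jl ik !eqxx as_.
have [z pz zmin] := ex_minnP (ex_intro _ z0 pz0).
exists z; last first.
  suff <- : zs z = s by exact: dP.
  move: pz => /and5P[zjl zik /eqP e za /eqP zc].
  have [ej ek ei] := encode_inj jl ik zjl zik e.
  rewrite -ej -ek in za zc.
  by apply: count_accepted_inj za as_ _; rewrite zc -ei.
apply/cP; split=> // m mz; apply/negP => /zmin.
by rewrite leqNgt mz.
Qed.

Lemma size_str_num p : 2 ^ size p <= (str_num p).+1.
Proof. by elim: p => //= b p IHp; rewrite expnS; lia. Qed.

Lemma KC_halting_problem_le (U : code) :
  optimal U -> exists c, forall sigma k j l A,
  j < 2 ^ l ->
  (forall Y, Y `<=` A -> unbounded Y ->
    exists2 p, p < 2 ^ k.+1 & eval Y U p (str_num sigma)) ->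
  (forall N, exists M, forall m, M <= m ->
    m <= 2 ^ j * count (fun a => (a \in A) && (N <= a)) (iota 0 m)) ->
  KC U halting_problem sigma <= k + j + 2 * l + c.
Proof.
move=> optU; have [c0 c0P] := refuter U.
have [M MP] := decoder (code_num c0); have [c cP] := optU M.
(* 3 comes from [encode_lt], and [c] is the cost of simulating the decoder. *)
exists (3 + c) => sigma k j l A jl AY Ad.
have accP s w : acceptor (code_num c0) k j s w <->
    fresh s w /\ satisfiable U k j (bit (w + 2 ^ s)).
  rewrite /acceptor satisfiable_refuted -c0P -halting_problemE.
  by split=> [/andP[-> /negP]|[-> /negP]].
have [s [as_ sv ik]] := accepted_complete accP AY Ad.
have [str strK numK] := str_num_bij.
have := MP l j k s jl ik as_; set n := encode _ _ _ _ => nE.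
have [|q qle /(KC_P _ _ optU).2 le] := cP halting_problem (str n) sigma.
  by rewrite /runs numK -sv.
apply: leq_trans le (leq_trans qle _).
rewrite addnA leq_add2r -(@leq_exp2l 2) //.
apply: leq_trans (size_str_num _) _; rewrite numK.
exact: encode_lt.
Qed.

(** * Densities and logarithms *)

Local Open Scope ring_scope.

Lemma infinite_unbounded (Y : set nat) : unbounded Y -> infinite_set Y.
Proof.
move=> Yu /finite_seqP[s Ys]; have [n ns] := Yu (\sum_(i <- s) i).+1%N.
rewrite Ys /= => nins; move: ns.
by rewrite (big_rem n) //= ltnNge leq_addr.
Qed.

Lemma lower_density_eventually (R : realType) (A : set nat) (e : R) :
  e < lower_density R A -> exists n0, forall m, (n0 < m)%N ->
    e * m%:R < (count (mem A) (iota 0 m))%:R.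
Proof.
rewrite /lower_density; set u := (fun n : nat => _ / _).
have uE n : u n = (count (mem A) (iota 0 n.+1))%:R / n.+1%:R.
  rewrite /u count_sum -[iota 0 n.+1]/(index_iota 0 n.+1) big_mkord.
  by [].
have u01 n : 0 <= u n <= 1.
  rewrite uE divr_ge0 // andTb ler_pdivrMr // mul1r ler_nat.
  by apply: leq_trans (count_size _ _) _; rewrite size_iota.
have ub : bounded_fun u.
  exists 1; split; first exact: num_real.
  move=> x x1 n _; have /andP[u0 u1] := u01 n.
  by rewrite /= ger0_norm //; apply: le_trans u1 (ltW x1).
rewrite limn_infE // => elt.
(* The lower limit is the supremum of the tail infima, so one of these exceeds [e]. *)
have [_ [n0 _ <-] en0] : exists2 y, range (infs u) y & e < y.
  by apply: sup_gt elt; exists (infs u 0%N); exists 0%N.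
exists n0 => -[//|m] n0m; rewrite -ltr_pdivlMr ?ltr0n // -uE.
apply: lt_le_trans en0 _; apply: ge_inf; last by exists m.
by exists 0 => _ [n _ <-]; case/andP: (u01 n).
Qed.

Lemma count_tail (A : set nat) N m :
  (count (mem A) (iota 0 m) <=
   count (fun a => (a \in A) && (N <= a)) (iota 0 m) + N)%N.
Proof.
have [Nm|mN] := leqP N m; last first.
  by apply: leq_trans (count_size _ _) _; rewrite size_iota; lia.
rewrite -{1 2}(subnKC Nm) !iotaD !count_cat.
have -> : count (mem A) (iota (0 + N) (m - N)) =
    count (fun a => (a \in A) && (N <= a)%N) (iota (0 + N) (m - N)).
  apply: eq_in_count => a; rewrite mem_iota => /andP[Na _].
  by rewrite /= Na andbT.
have := count_size (mem A) (iota 0 N); rewrite size_iota; lia.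
Qed.

Lemma lower_density_count (R : realType) (A : set nat) j :
  (2 ^+ j)^-1 < lower_density R A -> forall N, exists M, forall m, (M <= m)%N ->
    (m <= 2 ^ j * count (fun a => (a \in A) && (N <= a)) (iota 0 m))%N.
Proof.
move=> jA N; set p : R := (2 ^+ j)^-1 in jA.
have p0 : 0 < p by rewrite invr_gt0 exprn_gt0.
(* At a density strictly above 2^-j, the surplus (e - p) m eventually exceeds the at most N elements
   removed. *)
pose e := (p + lower_density R A) / 2.
have [n0 n0P] : exists n0, forall m, (n0 < m)%N ->
    e * m%:R < (count (mem A) (iota 0 m))%:R.
  by apply: lower_density_eventually; rewrite /e; lra.
have d0 : 0 < e - p by rewrite /e; lra.
exists (maxn n0.+1 (Num.truncn (N%:R / (e - p))).+1) => m.
rewrite geq_max => /andP[/n0P em tm].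
have Nm : N%:R < m%:R * (e - p).
  rewrite -ltr_pdivrMr //; apply: lt_le_trans (truncnS_gt _) _.
  by rewrite ler_nat.
rewrite -(ler_nat R) natrM natrX -ler_pdivrMl ?exprn_gt0 // -/p.
have := count_tail A N m; rewrite -(ler_nat R) natrD.
move: em Nm; set a := _%:R; set b := _%:R; set c := _%:R => em Nm ab.
by lra.
Qed.

Lemma str_num_lt p : (str_num p < 2 ^ (size p).+1)%N.
Proof.
(* The sharp bound, attained by strings of ones, is what the induction needs. *)
suff : (str_num p + 2 <= 2 ^ (size p).+1)%N by lia.
by elim: p => //= b p; rewrite [(2 ^ _.+2)%N]expnS; case: b; lia.
Qed.

Section Log2.
Variable R : realType.

Lemma ln2_gt0 : 0 < ln 2 :> R.
Proof. by apply: ln_gt0; rewrite ltr1n. Qed.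

Lemma log2_inv_ge0 (d : R) : 0 < d <= 1 -> 0 <= log2 (1 / d).
Proof.
move=> /andP[d0 d1]; rewrite /log2 divr_ge0 ?(ltW ln2_gt0) // ln_ge0 //.
by rewrite div1r invf_ge1.
Qed.

Lemma inv_exp2_lt (d : R) j : 0 < d -> log2 (1 / d) < j%:R -> (2 ^+ j)^-1 < d.
Proof.
move=> d0; rewrite /log2 ltr_pdivrMr ?ln2_gt0 // => dj.
rewrite -ltf_pV2 ?posrE ?invr_gt0 ?exprn_gt0 // invrK -div1r.
rewrite -ltr_ln ?posrE ?divr_gt0 ?exprn_gt0 //.
by rewrite lnXn // -[_ *+ j]mulr_natl.
Qed.

Lemma exp2_le_log2 (x : R) t :
  1 <= x -> (2 ^ t)%:R <= 2 * x -> t%:R <= 1 + log2 x.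
Proof.
move=> x1 tx; have x0 : 0 < x by lra.
rewrite -lerBlDl /log2 ler_pdivlMr ?ln2_gt0 // mulrBl mul1r lerBlDl.
rewrite -lnM ?posrE // [t%:R * _]mulr_natl -lnXn //.
rewrite ler_ln ?posrE ?exprn_gt0 ?mulr_gt0 //.
by rewrite -natrX.
Qed.

End Log2.

(* log log (1/delta) is negative or undefined for delta > 1/2, so the error
   term O(log log (1/delta)) is read as O(max(1, log log (1/delta))). *)
Theorem theorem1p7 (R : realType) (U : code) (optU : optimal U) :
  exists c : R, forall (sigma : seq bool) (delta : R) (A : set nat),
    0 < delta <= 1 ->
    delta <= lower_density R A ->
    (KC_family U (infinite_subsets A) sigma)%:R >=
      (KC U halting_problem sigma)%:R - log2 (1 / delta)
        - c * Num.max 1 (log2 (log2 (1 / delta))).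
Proof.
(* The excess over k + x + c is at most 1 from rounding j, 2 from l = t + 1, and 2t <= 4 [mx]; as
   [mx] >= 1, this gives 7. *)
have [c cP] := KC_halting_problem_le optU; exists (7 + c%:R).
move=> sigma delta A d01 dA; have /andP[d0 d1] := d01.
set x := log2 (1 / delta); have x0 : 0 <= x by exact: log2_inv_ge0.
set k := KC_family _ _ _; set mx := Num.max _ _.
have mx1 : 1 <= mx by rewrite le_max lexx.
have mxl : log2 x <= mx by rewrite le_max lexx orbT.
(* [j] is the least natural number above log(1/delta), so 2^-j < delta strictly; [j] fits in t + 1
   binary digits. *)
pose j := (Num.truncn x).+1; pose t := trunc_log 2 j.
have /andP[jx xj] : (Num.truncn x)%:R <= x < j%:R by exact: truncn_itv.
have /andP[tj jt] : (2 ^ t <= j < 2 ^ t.+1)%N by exact: trunc_log_bounds.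
have Ad := lower_density_count (lt_le_trans (inv_exp2_lt d0 xj) dA).
have Au : unbounded A.
  move=> N; have [M MP] := Ad N.
  (* The maximum with 1 makes the left side positive, which forces an element of [A] from [N] on. *)
  have := MP (maxn M 1) (leq_maxl _ _); set cnt := count _ _ => cntM.
  have : (0 < cnt)%N by move: cntM; case: cnt => //; rewrite muln0; lia.
  by rewrite -has_count => /hasP[a _ /andP[/set_mem Aa Na]]; exists a.
have [|_ kP] := @KC_familyP U (infinite_subsets A) sigma optU.
  by exists A; split=> //; exact: infinite_unbounded.
have := cP sigma k j t.+1 A jt _ Ad.
have AY Y : Y `<=` A -> unbounded Y ->
    exists2 p, (p < 2 ^ k.+1)%N & eval Y U p (str_num sigma).
  move=> YA /infinite_unbounded Yi.
  have [[p psz pr] _] := KC_P Y sigma optU; exists (str_num p) => //.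
  apply: leq_trans (str_num_lt p) _; rewrite leq_exp2l // ltnS psz.
  exact: kP.
move=> /(_ AY); rewrite -(ler_nat R) !natrD natrM => le.
have tl : t%:R <= 2 * mx.
  (* For j = 1 the iterated logarithm gives no bound, but t = 0. Otherwise x >= 1, so 2^t <= j <= 1
     + x <= 2x. *)
  have [j1|j1] := leqP j 1.
    have -> : t = 0%N by have := ltn_expl t (ltnSn 1); lia.
    by lra.
  have jxr : j%:R <= 1 + x by rewrite /j -natr1; lra.
  have x1 : 1 <= x by move: jxr; rewrite -(ler_nat R) in j1; lra.
  have : t%:R <= 1 + log2 x.
    apply: exp2_le_log2 => //.
    by apply: (@le_trans _ _ j%:R); [rewrite ler_nat|lra].
  by lra.
have c0 : 0 <= c%:R :> R by exact: ler0n.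
have jxr : j%:R <= 1 + x by rewrite /j -natr1; lra.
have cmx : c%:R <= c%:R * mx by rewrite ler_peMr.
move: le; rewrite -[t.+1]addn1 natrD.
by lra.
Qed.
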